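(* Let $\mathbf{K}$ be a pure simplicial complex of dimension $d$ satisfying the hereditary removal-collapsibility (HRC) condition. Then the second barycentric subdivision $\mathrm{sd}^2\,\mathbf{K}=\mathrm{sd}(\mathrm{sd}\,\mathbf{K})$ is star decomposable in vertices (that is, with $\mathbf{X}=\mathrm{sd}\,\mathbf{K}$, the pair $(\mathrm{sd}\,\mathbf{X},V(\mathbf{X}))$ is star decomposable in vertices).
   Context: Simplicial complexes are finite abstract simplicial complexes: finite set systems closed under taking subsets. A face with $k+1$ elements has dimension $k$; $\emptyset$ is a face of dimension $-1$ of every complex other than the void complex. The void complex $\emptyset$ (no faces, dimension $-\infty$) is distinguished from $\{\emptyset\}$ (dimension $-1$); a complex of dimension $d$ has $d\ge -1$. $V(\mathbf{K})$ is the vertex set. A facet is an inclusion-wise maximal face; a complex is pure if all its facets have the same dimension. The link of a face $\sigma\in\mathbf{K}$ is $\mathrm{lk}(\sigma,\mathbf{K})=\{\sigma'\setminus\sigma:\ \sigma'\in\mathbf{K},\ \sigma\subseteq\sigma'\}$; in particular $\mathrm{lk}(\emptyset,\mathbf{K})=\mathbf{K}$; for a vertex $v$ write $\mathrm{lk}(v,\mathbf{K})=\mathrm{lk}(\{v\},\mathbf{K})$. The barycentric subdivision is $\mathrm{sd}\,\mathbf{K}=\{\{\sigma_1,\dots,\sigma_n\}:\ n\ge 0,\ \sigma_i\in\mathbf{K},\ \emptyset\ne\sigma_1\subsetneq\cdots\subsetneq\sigma_n\}$. A vertex $v$ of $\mathbf{K}$ is identified with the vertex $\{v\}$ of $\mathrm{sd}\,\mathbf{K}$.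 Collapsibility: if a nonempty face $\sigma\in\mathbf{K}$ is properly contained in exactly one face $\tau$ of $\mathbf{K}$, then $\mathbf{K}\setminus\{\sigma,\tau\}$ arises from $\mathbf{K}$ by an elementary collapse. $\mathbf{K}$ is collapsible if some (possibly empty) sequence of elementary collapses reduces it to a point (a complex $\{\emptyset,\{v\}\}$). (RC) condition: a pure complex $\mathbf{K}$ satisfies the removal-collapsibility condition (RC) if either $\mathbf{K}$ is empty (meaning it has no vertices, i.e. $\mathbf{K}=\emptyset$ or $\mathbf{K}=\{\emptyset\}$), or there is a (possibly empty) set of facets $\phi_1,\dots,\phi_t$ of $\mathbf{K}$ such that $\mathbf{K}\setminus\{\phi_1,\dots,\phi_t\}$ (only the faces $\phi_i$ themselves are deleted) is collapsible. (HRC) condition: a pure complex $\mathbf{K}$ satisfies (HRC) if $\mathrm{lk}(\sigma,\mathbf{K})$ satisfies (RC) for every face $\sigma\in\mathbf{K}$, including $\sigma=\emptyset$. Star decomposability in vertices: let $\mathbf{X}$ be a pure $k$-dimensional complex, $k\ge -1$, and $X\subseteq V(\mathbf{X})$. Star decomposability in vertices of the pair $(\mathrm{sd}\,\mathbf{X},X)$ is defined by induction on $k$; one says that $\mathrm{sd}\,\mathbf{X}$ is star decomposable in vertices if the pair $(\mathrm{sd}\,\mathbf{X},V(\mathbf{X}))$ is. For $k=-1$, the pair $(\mathrm{sd}\{\emptyset\},\emptyset)=(\{\emptyset\},\emptyset)$ is star decomposable in vertices. For $k\ge 0$, $(\mathrm{sd}\,\mathbf{X},X)$ is star decomposable in vertices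 if there is a total order $\prec$ on $V(\mathbf{X})$ such that: (Order condition) $X=\{v\in V(\mathbf{X}): v\succeq w'\}$ for some $w'\in V(\mathbf{X})$; (Link condition) for every $w\in V(\mathbf{X})$ other than the last vertex of $\prec$, the pair $(\mathrm{sd}\,\mathrm{lk}(w,\mathbf{X}),\ \{v\in V(\mathrm{lk}(w,\mathbf{X})): v\succ w\})$ is star decomposable in vertices; (Last vertex condition) for the last vertex $\hat x$ of $\prec$, $\mathrm{sd}\,\mathrm{lk}(\hat x,\mathbf{X})$ is star decomposable in vertices. *)

(* Defs.v *)
From Stdlib Require Import Relation_Operators.
From mathcomp Require Import all_boot all_order all_algebra.

Set Implicit Arguments.
Unset Strict Implicit.
Unset Printing Implicit Defensive.

Import Order.TTheory GRing.Theory Num.Theory.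
Local Open Scope ring_scope.

(* A finite simplicial complex is a set of subsets of an ambient finite type
   [T]; points of [T] need not be vertices. The void complex (no
   faces) and the complex whose only face is empty are distinct, and both are
   simplicial complexes. *)

Section Complexes.

Variable T : finType.
Implicit Types (K L X : {set {set T}}) (s t : {set T}) (v w : T).

Definition simplicial_complex K : Prop :=
  forall s t, s \in K -> t \subset s -> t \in K.

Definition vertices K : {set T} := [set v | [set v] \in K].

Definition face_dim s : int := #|s|%:Z - 1.

(* The void complex has no dimension in this sense, so [has_dim K d] forces
   [K] to be nonvoid and [-1 <= d]. *)
Definition has_dim K (d : int) : Prop :=
  (exists2 s, s \in K & face_dim s = d) /\
  (forall s, s \in K -> face_dim s <= d).

Definition facets K : {set {set T}} := [set s | maxset (mem K) s].

Definition pure K : Prop :=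
  forall s t, s \in facets K -> t \in facets K -> face_dim s = face_dim t.

Definition link s K : {set {set T}} :=
  [set s' :\: s | s' in K & s \subset s'].

(* Faces are the finite chains of nonempty faces of [K]; [sdP] below gives the
   description by strictly increasing sequences. *)
Definition sd K : {set {set {set T}}} :=
  [set S : {set {set T}} |
    [&& S \subset K, set0 \notin S &
        [forall s in S, forall t in S, (s \subset t) || (t \subset s)]]].

Definition elementary_collapse K L : Prop :=
  exists s t,
    [/\ s \in K, s != set0, [set t' in K | s \proper t'] = [set t]
      & L = K :\: [set s; t]].

Definition collapsible K : Prop :=
  exists v, clos_refl_trans_1n _ elementary_collapse K [set set0; [set v]].

(* Meant for pure [K]. *)
Definition RC K : Prop :=
  K = set0 \/ K = [set set0] \/
  exists2 F : {set {set T}}, F \subset facets K & collapsible (K :\: F).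

(* Meant for pure [K]; all links of [K] are then pure as well. *)
Definition HRC K : Prop := forall s, s \in K -> RC (link s K).

(* [r v w] reads "v precedes or equals w"; only the values of [r] on [A]
   matter. *)
Definition total_order_on (A : {set T}) (r : rel T) : Prop :=
  [/\ {in A, reflexive r}, {in A &, antisymmetric r},
      {in A & &, transitive r} & {in A &, total r}].

(* [star_decomposable (sd X) A]: the pair (sd X, A) is star decomposable in
   vertices. The vertices of [X] are kept as elements of [T] rather than as the
   singletons that are the corresponding vertices of [sd X]. The induction on
   the dimension is the one of the inductive predicate: the link of a vertex of
   a pure k-dimensional complex is pure of dimension k - 1. In
   [star_decomposable_step], [x] is the last vertex. *)
Inductive star_decomposable : {set {set {set T}}} -> {set T} -> Prop :=
| star_decomposable_base : star_decomposable (sd [set set0]) set0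
| star_decomposable_step X (A : {set T}) (k : int) (r : rel T) (x : T) :
    simplicial_complex X -> pure X -> has_dim X k -> 0 <= k ->
    total_order_on (vertices X) r ->
    x \in vertices X -> {in vertices X, forall v, r v x} ->
    (exists2 w', w' \in vertices X & A = [set v in vertices X | r w' v]) ->
    (forall w, w \in vertices X -> w != x ->
       star_decomposable (sd (link [set w] X))
         [set v in vertices (link [set w] X) | r w v & v != w]) ->
    star_decomposable (sd (link [set x] X)) (vertices (link [set x] X)) ->
    star_decomposable (sd X) A.

Lemma sdP K (S : {set {set T}}) :
  reflect (exists c : seq {set T},
             [/\ sorted (fun s t => s \proper t) c, {subset c <= K},
                 set0 \notin c & S = [set:: c]])
          (S \in sd K).
Proof.
rewrite inE; apply: (iffP and3P) => [[/subsetP SK S0 Sch] | [c [cs cK c0 ->]]].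
  pose le (s t : {set T}) := s \subset t.
  have leS : {in mem S &, total le}.
    by move=> s t sS tS; move/forall_inP/(_ s sS)/forall_inP/(_ t tS): Sch.
  exists (sort le (enum S)).
  have memE s : (s \in sort le (enum S)) = (s \in S).
    by rewrite mem_sort mem_enum.
  split; first 1 last.
  - by move=> s; rewrite memE => /SK.
  - by rewrite memE.
  - by apply/setP=> s; rewrite inE memE.
  have le_tr : transitive le by move=> b a c; exact: subset_trans.
  have cs : sorted le (sort le (enum S)).
    apply: (sort_sorted_in leS); apply/allP => s; by rewrite mem_enum.
  have cu : uniq (sort le (enum S)) by rewrite sort_uniq enum_uniq.
  elim: (sort le _) cs cu => [|a [|b c] IH] //= /andP[ab bc] /andP[abc ubc].
  have /= -> := IH bc ubc; rewrite andbT properEneq (ab : a \subset b) andbT; apply: contraNneq abc => ->.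
  exact: mem_head.
split.
- by apply/subsetP=> s; rewrite inE => /cK.
- by rewrite inE.
apply/forall_inP=> s; rewrite inE => sc; apply/forall_inP=> t; rewrite inE => tc.
have ptr : transitive (fun s t : {set T} => s \proper t).
  by move=> b a d; exact: proper_trans.
have := cs; rewrite (sorted_pairwise ptr) => /(pairwiseP set0) cp.
have [ltst|ltts|eqst] := ltngtP (index s c) (index t c).
- have := cp _ _ _ _ ltst; rewrite !inE !index_mem sc tc !nth_index //.
  by move=> /(_ isT isT)/proper_sub->.
- have := cp _ _ _ _ ltts; rewrite !inE !index_mem sc tc !nth_index //.
  by move=> /(_ isT isT)/proper_sub->; rewrite orbT.
by rewrite -(nth_index set0 sc) eqst nth_index // subxx.
Qed.

End Complexes.

(* Main.v *)
(* For a chain [c] of nonempty faces of K, the link of [c] in sd K is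
   [sd (around c)], where [around c] is the set of faces comparable to all
   members of [c]. It is the join, over the gaps of [c], of subdivisions of
   boundaries of simplices and (for the top gap) of a link of K. Order the faces
   in a gap, from the last one in the total order to the first: a vertex, then
   the pairs of an anti-collapse of the gap minus some facets, adding the larger
   face t of a pair before its free face s, and then the removed facets. The
   part of the boundary of t already present is a simplex boundary minus one
   facet, while the link of s meets what is present in its whole boundary and in
   the single vertex t. Hence the class of initial parts whose trace on every
   gap is empty, full, or a stage of such an anti-collapse, with at least one
   trace of the third kind unless everything is present, is stable under passing
   to links, and the theorem follows by induction on the number of faces in
   [around c]. That any vertex of a gap can be taken as the first one is needed
   for the stage {t}; it holds because a collapsible complex collapses to each
   of its vertices. *)
From Stdlib Require Import Relation_Operators.
Require Import Defs.
From mathcomp Require Import all_boot all_order all_algebra.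
From mathcomp Require Import zify.

Set Implicit Arguments.
Unset Strict Implicit.
Unset Printing Implicit Defensive.

(** * Total orders built one vertex at a time *)

Section Reach.

Variable T : finType.
Implicit Types (X : {set {set T}}) (A B : {set T}) (w x : T) (s : seq T).

(* Vertices are added from the last one in the total order to the first. *)
Inductive reach X A : {set T} -> Prop :=
| reach_refl : reach X A A
| reach_add B w : reach X A B -> w \in vertices X -> w \notin B ->
    star_decomposable (sd (link [set w] X)) (B :&: vertices (link [set w] X)) ->
    reach X A (w |: B).

Lemma reach_trans X A B C : reach X A B -> reach X B C -> reach X A C.
Proof.
by move=> AB; elim=> [//|D w _ AD wX wD wSD]; apply: reach_add.
Qed.

Lemma reach_add1 X A w : w \in vertices X -> w \notin A ->
    star_decomposable (sd (link [set w] X)) (A :&: vertices (link [set w] X)) ->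
  reach X A (w |: A).
Proof. by apply: reach_add; apply: reach_refl. Qed.

(** The list runs against the total order: the part of [s] before [w] consists of vertices that come
    after [w] in the order. The vertex [x] is exempt because it is to be the last one, which has a
    link condition of its own. *)
Definition build_seq X x s :=
  uniq s /\ {in s, forall w, w != x ->
    star_decomposable (sd (link [set w] X))
      ([set v in take (index w s) s] :&: vertices (link [set w] X))}.

(** Keeping [s] as a prefix allows two runs to be concatenated, one up to a given set and one beyond
    it, so that this set becomes an initial stretch of the list. *)
Lemma reach_build_seq X x s B : build_seq X x s -> reach X [set:: s] B ->
  exists2 s', build_seq X x (s ++ s') & B = [set:: s ++ s'].
Proof.
move=> s_ok; elim=> [|{}B w _ [s' [us ok] ->] wX ws wSD].
  by exists [::]; rewrite cats0.
exists (rcons s' w); last first.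
  by apply/setP=> v; rewrite -rcons_cat !inE mem_rcons in_cons.
rewrite inE in ws; rewrite -rcons_cat; split; first by rewrite rcons_uniq ws.
move=> v; rewrite mem_rcons in_cons -cats1 index_cat take_cat.
have [vs _ vx|vs] := boolP (v \in s ++ s').
  by rewrite index_mem vs; apply: ok.
rewrite orbF => /eqP-> _; rewrite /= eqxx addn0 ltnn subnn take0 cats0.
exact: wSD.
Qed.

Lemma reach_star_decomposable X (k : int) x A :
    simplicial_complex X -> pure X -> has_dim X k -> (0 <= k)%R ->
    x \in vertices X ->
    star_decomposable (sd (link [set x] X)) (vertices (link [set x] X)) ->
    reach X [set x] A -> reach X A (vertices X) ->
  star_decomposable (sd X) A.
Proof.
move=> Xcomp Xpure Xdim k0 xX xSD xA AX.
have: build_seq X x [:: x].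
  by split=> // w; rewrite inE => /eqP->; rewrite eqxx.
have e1 : [set x] = [set:: [:: x]] by apply/setP=> v; rewrite !inE.
rewrite e1 in xA => x_ok; have := reach_build_seq x_ok xA.
case=> s1 ok1 Adef; rewrite Adef in AX.
have [s2 [us ok] Xdef] := reach_build_seq ok1 AX.
set s := (_ ++ s1) ++ s2 in us ok Xdef.
have memX v : (v \in vertices X) = (v \in s) by rewrite Xdef inE.
(* The order is the reverse of the list, so [x], at index 0, is its maximum. *)
pose r v w := index w s <= index v s.
apply: (@star_decomposable_step _ X A k r x) => //.
- split.
  + by move=> v _; rewrite /r.
  + move=> v w; rewrite !memX => vs ws; rewrite /r -eqn_leq => /eqP e.
    by rewrite -(nth_index x vs) -e nth_index.
  + by move=> v u w _ _ _ /[swap]; apply: leq_trans.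
  + by move=> v w _ _; rewrite /r leq_total.
- by move=> v _; rewrite /r /s /= eqxx.
(* The threshold is the vertex of [A] added last, at index [size s1]. *)
- exists (last x s1); first by rewrite memX mem_cat cat1s mem_last.
  apply/setP=> v; rewrite Adef inE [RHS]inE memX /r.
  have u1 : uniq (x :: s1) by case: ok1.
  have e : index (last x s1) s = size s1.
    rewrite index_cat cat1s mem_last.
    by rewrite -[last x s1](nth_last x (x :: s1)) index_uniq.
  rewrite e /s mem_cat index_cat cat1s.
  have [vs|vs] := boolP (v \in x :: s1).
    have : index v (x :: s1) < size (x :: s1) by rewrite index_mem.
    by rewrite ltnS -mem_cat cat1s mem_cat vs => h; symmetry; exact: h.
  by rewrite -mem_cat cat1s (negPf vs) /= addSn ltnNge leq_addr andbF.
- move=> w wX wx; have := ok w; rewrite -memX => /(_ wX wx).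
  congr star_decomposable; apply/setP=> v; rewrite !inE andbC.
  have [vL|vL] := boolP (v \in vertices (link [set w] X)); last first.
    by rewrite /vertices inE in vL *; rewrite (negPf vL).
  have vX : v \in s.
    rewrite -memX inE; move: vL; rewrite inE => /imsetP[t]; rewrite inE => /andP[tX _] e.
    by apply: (Xcomp t) => //; rewrite e subsetDl.
  move: vL; rewrite inE => -> /=.
  rewrite in_take // ltn_neqAle andbC; congr (_ && _); congr (~~ _).
  apply/eqP/eqP=> [e|-> //]; rewrite memX in wX.
  by rewrite -(nth_index x vX) e nth_index.
Qed.

End Reach.

(** * Anti-collapses *)

Section Expansion.

Variable T : finType.
Implicit Types (E L W : {set {set T}}) (a b s t u w y z : {set T}) (p : T).

(** Each step is an elementary collapse read backwards, with [s] a free face of [t]. The ambient [E]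
    need not be a complex: it will be a gap, whose lower bound is missing, so only the faces of [t]
    lying in [E] have to be present. *)
Inductive expands E L : {set {set T}} -> Prop :=
| expands_refl : expands E L L
| expands_add L1 s t : expands E L L1 -> s \in E -> t \in E ->
    s \notin L1 -> t \notin L1 -> s \proper t -> #|t| = #|s|.+1 ->
    {in E, forall u, u \proper t -> u != s -> u \in L1} ->
    {in L1, forall u, ~~ (s \proper u)} ->
  expands E L (s |: (t |: L1)).

Lemma expands_sub E L L' : expands E L L' -> L \subset L'.
Proof.
elim=> // L1 s t _ /subset_trans-> //.
by rewrite setUA subsetUr.
Qed.

Lemma expands_subE E L L' : L \subset E -> expands E L L' -> L' \subset E.
Proof.
move=> LE; elim=> // L1 s t _ L1E sE tE _ _ _ _ _ _.
by rewrite !subUset !sub1set sE tE.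
Qed.

(** Over [a], the face [t] is an edge; its endpoint other than [y] is [t] without the element that
    [y] adds to [a]. *)
Lemma edge_other_vertex a t y : a \proper y -> y \proper t ->
  #|t| = #|a|.+2 -> exists u, [/\ u != y, a \proper u, u \proper t,
    #|u| = #|a|.+1 & forall w, a \proper w -> w \proper t -> w = y \/ w = u].
Proof.
move=> ay yt ct; have := proper_card ay; have := proper_card yt.
rewrite ct => h1 h2; have cy : #|y| = #|a|.+1 by lia.
have [sya syt] := (proper_sub ay, proper_sub yt).
have sub : y :\: a \subset t by rewrite subDset subsetU // syt ?orbT.
have cu : #|t :\: (y :\: a)| = #|a|.+1.
  by rewrite cardsDS // cardsDS // ct cy; lia.
have au : a \subset t :\: (y :\: a).
  rewrite subsetD (subset_trans sya syt) -setI_eq0.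
  by apply/eqP/setP=> v; rewrite !inE; case: (v \in a).
exists (t :\: (y :\: a)); split=> //.
- have [_ [v vy va]] := properP ay; apply/eqP=> e.
  by move: (vy); rewrite -e !inE va vy.
- by rewrite properEcard au cu /= ltnSn.
- by rewrite properEcard subsetDl cu ct /= ltnSn.
move=> w aw wt; have [->|wy] := eqVneq w y; [by left | right].
have := proper_card aw; have := proper_card wt; rewrite ct => h3 h4.
have cw : #|w| = #|a|.+1 by lia.
have wya : w :&: y = a.
  apply/esym/eqP; rewrite eqEcard subsetI !proper_sub //=.
  have : w :&: y \proper w.
    rewrite properE subsetIl /=; apply: contraNN wy => wwy.
    by rewrite eqEcard cy cw leqnn andbT (subset_trans wwy) ?subsetIr.
  by move/proper_card; rewrite cw.
apply/eqP; rewrite eqEcard subsetD (proper_sub wt) -setI_eq0 setIDA wya setDv.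
by rewrite eqxx cu cw /=.
Qed.

(* If the new pair is a vertex s and an edge joining it to u, start from s, add
   the edge and u, and repeat the anti-collapse that starts from u. *)
Lemma expands_rebase a E v L y :
    {in E, forall u, a \proper u} ->
    {in E, forall u w, a \proper w -> w \subset u -> w \in E} ->
    #|y| = #|a|.+1 -> expands E [set v] L -> y \in L -> y \in E ->
  expands E [set y] L.
Proof.
move=> aE Ed + vL; elim: vL y => [|L0 s t vL0 IH sE tE sL0 tL0 st ct below nocof] y cy.
  by rewrite inE => /eqP<- _; apply: expands_refl.
rewrite !inE => /or3P[/eqP e|/eqP e|yL0] yE; first last.
- by apply: expands_add => //; apply: IH.
- have := proper_card (aE _ sE).
  by have := proper_card st; rewrite -e cy => ? ?; lia.
subst y.
have as_ := aE _ sE; have ta := aE _ tE.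
have {}ct : #|t| = #|a|.+2 by rewrite ct cy.
have [u [us au ut cu uP]] := edge_other_vertex as_ st ct.
have uE : u \in E by apply: Ed tE _ au (proper_sub ut).
have uL0 : u \in L0 by apply: below.
have {}IH := IH u cu uL0 uE.
have nosub w z : w \in E -> #|z| = #|a|.+1 -> ~~ (w \proper z).
  move=> wE cz; apply/negP => /proper_card.
  by rewrite cz ltnS leqNgt (proper_card (aE _ wE)).
suff trans M : expands E [set u] M -> s \notin M -> t \notin M ->
    expands E [set s] (s |: (t |: M)).
  exact: trans.
elim=> [|L1 s' t' uL1 {}IH s'E t'E s'L1 t'L1 st' ct' below' nocof'].
  rewrite !inE => su tu.
  (* With [s] alone present, the edge [t] enters together with its free endpoint [u]. *)
  have -> : s |: (t |: [set u]) = u |: (t |: [set s]).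
    by apply/setP=> w; rewrite !inE; do 3!case: eqP.
  apply: expands_add; rewrite ?inE //; first exact: expands_refl.
  - by rewrite eq_sym; apply: contraTneq st => ->; rewrite properxx.
  - by rewrite ct cu.
  - move=> w wE wt wu; rewrite inE; have [-> //|e] := uP w (aE _ wE) wt.
    by rewrite e eqxx in wu.
  - by move=> w; rewrite inE => /eqP->; rewrite nosub.
rewrite !inE !negb_or => /and3P[ss' st'' sL1] /and3P[ts' tt' tL1].
have -> : s |: (t |: (s' |: (t' |: L1))) = s' |: (t' |: (s |: (t |: L1))).
  by rewrite !(setUCA _ [set s']) !(setUCA _ [set t']).
apply: expands_add => //; first exact: IH.
- by rewrite !inE !negb_or eq_sym ss' eq_sym ts'.
- by rewrite !inE !negb_or eq_sym st'' eq_sym tt'.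
- by move=> w wE wt ws; rewrite !inE below' ?orbT.
move=> w; rewrite !inE => /or3P[/eqP->|/eqP->|]; last exact: nocof'.
- exact: nosub.
(* A free face [s'] below the edge [t] would be [s] or [u]; it differs from [s], and [u] is present
   from the start. *)
- apply/negP=> s't; have [e|e] := uP s' (aE _ s'E) s't.
    by rewrite e eqxx in ss'.
  move/negP: s'L1; apply; rewrite e.
  by apply: (subsetP (expands_sub uL1)); rewrite inE.
Qed.

(* Away from the apex [p |: a], the pairs are w and p |: w for w avoiding p. *)
Lemma simplex_collapsible a b p :
    a \proper b :\ p -> p \in b ->
    let E := [set u : {set T} | a \proper u & u \proper b] in
  expands E [set p |: a] (E :\ (b :\ p)).
Proof.
move=> abp pb E.
pose I := [set w : {set T} | a \proper w & w \proper b :\ p].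
(* The apex together with the pairs over [W]. The apex [p |: a] is unpaired because its partner [a]
   is outside [E]; likewise the partner [b] of [b :\ p] is outside [E], which is why [b :\ p] is
   removed. *)
pose L (W : {set {set T}}) := [set u : {set T} | (u == p |: a) || (u :\ p \in W)].
have sub_p w : w \subset b :\ p -> p \notin w.
  by rewrite subsetD1 => /andP[].
have pa : p \notin a by apply: sub_p (proper_sub abp).
have D1_id w : p \notin w -> w :\ p = w.
  by move=> pw; apply/setDidPl; rewrite disjoint_sym disjoints1.
have D1_eq u w : p \notin w -> (u :\ p == w) = (u == w) || (u == p |: w).
  move=> pw; apply/eqP/orP => [<-|[]/eqP->]; [|exact: D1_id|exact: setU1K].
  have [pu|pu] := boolP (p \in u); first by right; rewrite setD1K.
  by left; rewrite D1_id.
have -> : E :\ (b :\ p) = L I.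
  apply/setP=> u; rewrite !inE; apply/idP/idP => [/and3P[ubp au ub]|].
    have [//|upa /=] := eqVneq u (p |: a).
    rewrite !properEneq; apply/andP; split; apply/andP; split.
    - rewrite eq_sym D1_eq // negb_or upa andbT.
      by apply: contraTneq au => ->; rewrite properxx.
    - by rewrite subsetD1 (proper_sub au).
    - rewrite D1_eq ?setD11 // negb_or ubp setD1K //.
      by apply: contraTneq ub => ->; rewrite properxx.
    - by rewrite setSD ?(proper_sub ub).
  case/orP=> [/eqP->|/andP[au ub]].
    rewrite properEcard subsetUr cardsU1 pa ltnSn /= andbC.
    have -> : p |: a != b :\ p.
      by apply/eqP=> /setP/(_ p); rewrite !inE eqxx.
    rewrite -[b](setD1K pb) properEcard !cardsU1 pa !inE eqxx /= ltnS.
    by rewrite setUS ?proper_card ?proper_sub.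
  apply/and3P; split.
  - by apply: contraTneq ub => ->; rewrite D1_id ?setD11 ?properxx.
  - exact: proper_sub_trans au (subD1set _ _).
  - rewrite properE; apply/andP; split.
      rewrite -[b](setD1K pb) -subDset; exact: proper_sub.
    by apply: contraL ub => /(setSD [set p]) h; rewrite properE h andbF.
(* Induction over families closed downwards above [a]. The pair of a largest [w] comes last, so that
   nothing present lies above [w] and all other faces of [p |: w] are already there. *)
suff: forall n W, #|W| = n -> W \subset I ->
    {in W, forall w u, a \proper u -> u \subset w -> u \in W} ->
    expands E [set p |: a] (L W).
  move=> /(_ _ _ erefl); apply => // w; rewrite inE => /andP[_ wb] u au uw.
  by rewrite inE au (sub_proper_trans uw).
elim=> [|n IH] W cW WI Wd.
  have -> : L W = [set p |: a]; last exact: expands_refl.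
  by move/eqP: cW; rewrite cards_eq0 => /eqP->; apply/setP=> u; rewrite !inE orbF.
have [w0 w0W] : exists w : {set T}, w \in W by apply/card_gt0P; rewrite cW.
have [w wW wmax] : exists2 w, w \in W & {in W, forall v : {set T}, #|v| <= #|w|}.
  case: (arg_maxnP (fun w : {set T} => #|w|) w0W) => w wW wmax.
  by exists w.
have := subsetP WI _ wW; rewrite inE => /andP[aw wb].
have pw := sub_p _ (proper_sub wb).
have -> : L W = w |: ((p |: w) |: L (W :\ w)).
  apply/setP=> u; rewrite [LHS]inE 2!in_setU1 orbA -D1_eq // !inE.
  by case: (u :\ p =P w) => [-> | _]; rewrite ?wW ?orbT.
have sI : W :\ w \subset I by rewrite (subset_trans (subsetDl _ _)).
have b_pb : b :\ p \proper b by rewrite properD1.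
have pa_w : w != a by apply: contraTneq aw => ->; rewrite properxx.
have wpa : w != p |: a by apply: contraNneq pw => ->; rewrite setU11.
apply: expands_add.
- apply: IH => //; first by have := cardsD1 w W; rewrite wW cW => -[].
  move=> v; rewrite !inE => /andP[vw vW] u au uv; rewrite in_setD1 (Wd v vW u au uv) andbT.
  apply: contraNneq vw => e; rewrite e in uv.
  by rewrite eq_sym eqEcard uv; apply: wmax.
- by rewrite inE aw (proper_trans wb).
- rewrite inE (proper_sub_trans aw) ?subsetUr //=.
  rewrite -[b](setD1K pb) properEcard !cardsU1 pw !inE eqxx /= ltnS.
  by rewrite setUS ?proper_card ?proper_sub.
- by rewrite !inE (negPf wpa) D1_id // eqxx.
- rewrite !inE setU1K // eqxx orbF; apply: contraNneq pa_w => e.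
  by rewrite -[w](setU1K pw) e setU1K.
- by rewrite properUr // sub1set.
- by rewrite cardsU1 pw.
- move=> u; rewrite inE => /andP[au _] ut uw; rewrite !inE.
  have [//|upa /=] := eqVneq u (p |: a).
  have uw' : u :\ p != w.
    rewrite D1_eq // (negPf uw) /=; apply: contraTneq ut => ->.
    by rewrite properxx.
  rewrite uw' /=; apply: Wd wW _ _ _; last by rewrite subDset proper_sub.
  rewrite properEneq subsetD1 (proper_sub au) pa andbT eq_sym D1_eq // negb_or upa.
  by rewrite !andbT; apply: contraTneq au => ->; rewrite properxx.
- move=> u; rewrite !inE => /orP[/eqP->|/andP[uw uW]]; apply/negP=> h.
    move: (proper_sub h); rewrite -subDset D1_id // => wa.
    by move: aw; rewrite properE wa andbF.
  have := wmax _ uW; rewrite leqNgt => /negP; apply; apply: proper_card.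
  by rewrite properEneq eq_sym uw subsetD1 proper_sub.
Qed.

End Expansion.

(** * From collapses in a link to anti-collapses above a face *)

Section Collapse.

Variable T : finType.
Implicit Types (K L E F c : {set {set T}}) (a b s t u w y : {set T}) (p v : T).

Lemma setDUK a u : a \subset u -> (u :\: a) :|: a = u.
Proof.
move=> /subsetP au; apply/setP=> x; rewrite !inE.
by have [/au->|_] := boolP (x \in a); rewrite ?orbT ?orbF.
Qed.

Lemma in_link a K s : (s \in link a K) = [disjoint s & a] && (s :|: a \in K).
Proof.
apply/imsetP/andP => [[t]|[sa saK]].
  rewrite inE => /andP[tK at_] ->; rewrite -setI_eq0 setIDAC -setIDA setDv setI0.
  by rewrite setDUK.
exists (s :|: a); first by rewrite inE saK subsetUr.
by rewrite setDUl setDv setU0; apply/esym/setDidPl.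
Qed.

(** Adding [a] to every face carries the link of [a] to the faces containing [a]; the empty face
    goes to [a] itself, which [E] leaves out. The first collapse becomes the last pair added. *)
Lemma collapse_expands K a L v :
    L \subset link a K -> simplicial_complex L ->
    clos_refl_trans_1n _ (@elementary_collapse T) L [set set0; [set v]] ->
  let E := [set u in K | a \proper u] in
  expands E [set v |: a] [set u in E | u :\: a \in L].
Proof.
move=> + + coll E; move e : [set _; _] coll => L' coll.
elim: coll e => [{}L <- LK _|{}L L1 {}L' [s [t [sL s0 tP L1E]]] _ IH e LK Lc].
  suff -> : [set u in E | u :\: a \in [set set0; [set v]]] = [set v |: a].
    exact: expands_refl.
  have := subsetP LK [set v]; rewrite !inE eqxx orbT => /(_ isT).
  rewrite in_link disjoints1 => /andP[va vaK].
  apply/setP=> u; rewrite !inE; apply/idP/eqP => [|->].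
    case/andP=> /andP[_ au] /orP[|/eqP e]; last by rewrite -e setDUK ?proper_sub.
      by rewrite setD_eq0 => ua; move: au; rewrite properE ua andbF.
  rewrite vaK properUr ?sub1set //= setDUl setDv setU0.
  by rewrite (setDidPl _) ?disjoints1 // eqxx orbT.
have : t \in [set t' in L | s \proper t'] by rewrite tP inE.
rewrite inE => /andP[tL st].
have sP u : u \in L -> s \proper u -> u = t.
  by move=> uL su; apply/set1P; rewrite -tP inE uL.
have L1L : L1 \subset L by rewrite L1E subsetDl.
(* A remaining face above [s] or [t] would properly contain [s], and only [t] does. *)
have L1c : simplicial_complex L1.
  move=> u w; rewrite L1E !inE negb_or => /andP[/andP[us ut] uL] wu.
  rewrite (Lc _ _ uL wu) andbT; apply/norP; split.
    apply: contraNneq ut => ws; apply/eqP; apply: sP => //.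
    by rewrite properEneq eq_sym us -ws.
  apply: contraNneq ut => wt; rewrite wt in wu.
  by rewrite (sP u uL) ?(proper_sub_trans st wu).
have {}IH := IH e (subset_trans L1L LK) L1c.
(* Adding to [s] an element of [t] outside it gives a face properly containing [s], hence [t]. *)
have ct : #|t| = #|s|.+1.
  have [_ [p pt ps]] := properP st.
  rewrite -(sP (p |: s)) ?cardsU1 ?ps //.
    by apply: Lc tL _; rewrite subUset sub1set pt proper_sub.
  by rewrite properUr // sub1set.
have dis u : u \in L -> [disjoint u & a].
  by move=> uL; have := subsetP LK u uL; rewrite in_link => /andP[].
have UK u : u \in L -> u :|: a \in K.
  by move=> uL; have := subsetP LK u uL; rewrite in_link => /andP[].
have UD u : u \in L -> (u :|: a) :\: a = u.
  by move=> uL; rewrite setDUl setDv setU0; apply/setDidPl/dis.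
have UE u : u \in L -> u != set0 -> u :|: a \in E.
  move=> uL u0; rewrite inE UK // properUr //; apply: contraNN u0 => ua.
  by have := dis u uL; rewrite -setI_eq0 (setIidPl ua).
have DU u : a \proper u -> (u :\: a) :|: a = u.
  by move=> au; rewrite setDUK ?proper_sub.
have t0 : t != set0 by rewrite -card_gt0 ct.
have -> : [set u in E | u :\: a \in L] =
    (s :|: a) |: ((t :|: a) |: [set u in E | u :\: a \in L1]).
  apply/setP=> u; rewrite inE !in_setU1 inE.
  have [->|us] /= := eqVneq u (s :|: a); first by rewrite UD // sL UE.
  have [->|ut] /= := eqVneq u (t :|: a); first by rewrite UD // tL UE.
  have [|//] := boolP (u \in E); rewrite inE => /andP[_ au] /=.
  rewrite L1E !inE; case: eqP => [e1|_ /=]; first by rewrite -e1 DU // eqxx in us.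
  by case: eqP => [e1|//]; rewrite -e1 DU // eqxx in ut.
have cU u : u \in L -> #|u :|: a| = #|u| + #|a|.
  by move=> uL; have := dis u uL; rewrite -leq_card_setU => /eqP.
apply: expands_add => //; try exact: UE.
- by rewrite inE UD // L1E !inE eqxx andbF.
- by rewrite inE UD // L1E !inE eqxx orbT andbF.
- by rewrite properEcard setSU ?proper_sub //= !cU // ct addSn.
- by rewrite !cU // ct addSn.
- move=> u uE ut us; rewrite inE uE /= L1E !inE.
  have au : a \proper u by move: uE; rewrite inE => /andP[].
  have sub : u :\: a \subset t.
    by rewrite subDset setUC proper_sub.
  rewrite (Lc _ _ tL sub) andbT; apply/norP; split.
    by apply: contraNneq us => <-; rewrite DU.
  by apply: contraTneq ut => <-; rewrite DU // properxx.
move=> u; rewrite inE => /andP[]; rewrite inE => /andP[uK au] uL1.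
apply/negP=> su; have uL := subsetP L1L _ uL1.
suff e1 : u :\: a = t by move: uL1; rewrite e1 L1E !inE eqxx orbT.
apply: sP => //; rewrite properE subsetD dis // andbT.
apply/andP; split; first exact: subset_trans (subsetUl s a) (proper_sub su).
by apply: contraTN su; rewrite subDset setUC => h; rewrite properE h andbF.
Qed.

End Collapse.

(** * Gaps of a chain of faces and the stages of their anti-collapses *)

Section Gaps.

Variables (T : finType) (K : {set {set T}}) (n : nat).
Hypotheses (K_complex : simplicial_complex K)
  (K_facets : {in facets K, forall s : {set T}, #|s| = n}) (K_HRC : HRC K).
Implicit Types (A E F L c : {set {set T}}) (a b s t u w y z : {set T}) (p v : T).

(* The faces strictly between [a] and the next member of [c]; [a] ranges over
   [set0 |: c]. *)
Definition gap c a := [set u in K |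
  (a \proper u) && [forall b in c, (b \subset a) || (u \proper b)]].

Lemma gapP c a u : reflect [/\ u \in K, a \proper u &
    {in c, forall b : {set T}, b \subset a \/ u \proper b}] (u \in gap c a).
Proof.
rewrite inE; apply: (iffP and3P) => -[uK au].
  by move/forall_inP=> h; split=> // b /h /orP.
by move=> h; split=> //; apply/forall_inP=> b /h /orP.
Qed.

(** Both halves of the anti-collapse are kept: the one up to [L] serves to build an initial part
    from [y], the one from [L] on to fill the gap, after which the members of [F] can be added. *)
Definition partial E L := exists y F, [/\ y \in E,
  {in F & E, forall s u : {set T}, ~~ (s \proper u)}, expands E [set y] L
  & expands E L (E :\: F)].

Definition gap_state E L := [\/ L = set0, partial E L | L = E].

Lemma sd_chain c s t : c \in sd K -> s \in set0 |: c -> t \in set0 |: c ->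
  s \subset t \/ t \subset s.
Proof.
rewrite inE => /and3P[_ _ /forall_inP ch].
case/setU1P=> [->|sc]; first by rewrite sub0set; left.
case/setU1P=> [->|tc]; first by rewrite sub0set; right.
by apply/orP; have /forall_inP := ch s sc; apply.
Qed.

Lemma card_le_n s : s \in K -> #|s| <= n.
Proof.
move=> sK; have [t tK st] := @maxset_exists _ (mem K) s sK.
have <- : #|t| = n by apply: K_facets; rewrite inE.
exact: subset_leq_card.
Qed.

Lemma vertex_setU1 a y : a \proper y -> #|y| = #|a|.+1 ->
  exists2 p, p \notin a & y = p |: a.
Proof.
move=> ay cy; have [_ [p py pa]] := properP ay; exists p => //.
apply/esym/eqP; rewrite eqEcard subUset sub1set py proper_sub //=.
by rewrite cardsU1 pa cy.
Qed.

(** The sets strictly between [a] and [b] form the boundary of a simplex. The only set in [F] is the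
    facet opposite to the apex, and the two values of [L] are the first and the last stage. *)
Lemma simplex_partial a b p L : a \proper b :\ p -> p \in b ->
    let E := [set u : {set T} | a \proper u & u \proper b] in
  L = [set p |: a] \/ L = E :\ (b :\ p) -> partial E L.
Proof.
move=> abp pb E LE; have Ex := simplex_collapsible abp pb.
have pa : p \notin a by have := proper_sub abp; rewrite subsetD1 => /andP[].
exists (p |: a), [set b :\ p]; split.
- rewrite inE properUr ?sub1set //= -[b](setD1K pb) properEcard.
  rewrite setUS ?(proper_sub abp) //= !cardsU1 pa setD11 ltnS.
  exact: proper_card abp.
- move=> s u; rewrite !inE => /eqP-> /andP[_ ub].
  apply/negP => /proper_card; have := proper_card ub; rewrite (cardsD1 p b) pb.
  by lia.
- by case: LE => -> //; apply: expands_refl.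
by case: LE => -> //; apply: expands_refl.
Qed.

Lemma vertex_partial_simplex a b y : a \proper y -> y \proper b ->
    #|y| = #|a|.+1 ->
  partial [set u : {set T} | a \proper u & u \proper b] [set y].
Proof.
move=> ay yb cy; have [p pa ye] := vertex_setU1 ay cy.
have pb : p \in b by rewrite (subsetP (proper_sub yb)) // ye setU11.
apply: (@simplex_partial _ _ p) => //; last by left; rewrite ye.
have sab := proper_sub (proper_trans ay yb).
rewrite properEcard subsetD1 sab pa /=.
by have := proper_card yb; rewrite (cardsD1 p b) pb cy.
Qed.

Lemma facet_removed_partial a s t : a \proper s -> s \proper t ->
    #|t| = #|s|.+1 ->
  let E := [set u : {set T} | a \proper u & u \proper t] in
  partial E (E :\ s).
Proof.
move=> as_ st ct E; have [p ps te] := vertex_setU1 st ct.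
have se : t :\ p = s by rewrite te setU1K.
apply: (@simplex_partial _ _ p); rewrite ?se //; last by right.
by rewrite te setU11.
Qed.

(** By (HRC), the link of [a] minus some facets collapses to a point. Read backwards above [a], this
    is an anti-collapse from some vertex, and [expands_rebase] moves its start to [y]. *)
Lemma vertex_partial_link a y : a \proper y -> y \in K -> #|y| = #|a|.+1 ->
  partial [set u in K | a \proper u] [set y].
Proof.
move=> ay yK cy; set E := [set u in K | _].
have yE : y \in E by rewrite inE yK.
(* If [y] is itself a facet, (RC) might remove it. In that case [E] has no proper inclusions, and
   all of it but [y] can serve as the removed facets. *)
have [cn|cn] := eqVneq #|y| n.
  have EP : {in E &, forall s u : {set T}, ~~ (s \proper u)}.
    move=> s u; rewrite !inE => /andP[_ /proper_card as_] /andP[uK _].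
    apply/negP => /proper_card; have := card_le_n uK; lia.
  exists y, (E :\ y); split=> //.
  - by move=> s u; rewrite in_setD1 => /andP[_]; apply: EP.
  - exact: expands_refl.
  have -> : E :\: (E :\ y) = [set y].
    apply/setP=> u; rewrite !inE; case: eqVneq => [->|_ /=]; rewrite ?yK ?ay //.
    by rewrite andNb.
  exact: expands_refl.
have aK : a \in K by apply: K_complex yK (proper_sub ay).
have yl : y :\: a \in link a K by rewrite in_link -setI_eq0 setIDAC setDIl setDv setI0 eqxx setDUK ?proper_sub.
have [e|[e|[F FK [v coll]]]] := K_HRC aK.
- by rewrite e inE in yl.
- move: yl; rewrite e inE setD_eq0 => ya.
  by move: ay; rewrite properE ya andbF.
have Lc : simplicial_complex (link a K :\: F).
  move=> s t; rewrite !inE => /andP[sF]; rewrite !in_link => /andP[sa saK] ts.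
  rewrite (disjointWl ts sa) (K_complex saK) ?setSU // !andbT.
  apply: contra sF => tF; have := subsetP FK _ tF; rewrite inE => /maxsetP[_].
  by move=> /(_ s) -> //=; rewrite in_link sa.
have := collapse_expands (subsetDl _ _) Lc coll; rewrite /= -/E.
pose FE := [set u in E | u :\: a \in F].
have lE u : u \in E -> u :\: a \in link a K.
  rewrite inE => /andP[uK au]; rewrite in_link setDUK ?proper_sub // uK.
  by rewrite -setI_eq0 setIDAC setDIl setDv setI0 eqxx.
have -> : [set u in E | u :\: a \in link a K :\: F] = E :\: FE.
  apply/setP=> u; rewrite [LHS]inE !in_setD [u \in FE]inE.
  have [uE|_] := boolP (u \in E); last by rewrite andbF.
  by rewrite (lE _ uE) !andbT.
(* Facets of the link come from facets of [K]; hence they are maximal in [E], and [y], whose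
   cardinality is not [n], is not among them. *)
have FEK u : u \in FE -> u \in facets K.
  rewrite inE => /andP[uE uF]; have := subsetP FK _ uF.
  move: (uE); rewrite !inE => /andP[uK au] /maxsetP[_ umax].
  apply/maxsetP; split=> // t tK ut; have at_ := proper_sub_trans au ut.
  have tE : t \in E by rewrite inE (tK : t \in K).
  have := umax (t :\: a) (lE _ tE) (setSD _ ut).
  by move=> e; rewrite -[t](setDUK (proper_sub at_)) e setDUK ?proper_sub.
have yFE : y \notin FE by apply: contra cn => /FEK/K_facets->.
move=> Ev; exists y, FE; split=> //.
- move=> s u /FEK; rewrite [s \in _]inE => /maxsetP[_ smax]; rewrite inE => /andP[uK _].
  apply/negP => su; have e := smax u uK (proper_sub su).
  by rewrite e properxx in su.
- exact: expands_refl.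
apply: (expands_rebase (a := a) _ _ cy Ev) => //.
- by move=> u; rewrite inE => /andP[].
- move=> u; rewrite inE => /andP[uK _] w aw wu.
  by rewrite inE aw (K_complex uK).
- by rewrite inE yFE.
Qed.

(** If some member of [c] lies properly above [a], the least one bounds the gap, which is the
    boundary of a simplex; otherwise the gap consists of all faces properly above [a]. *)
Lemma vertex_partial c a y : c \in sd K -> a \in set0 |: c ->
  y \in gap c a -> #|y| = #|a|.+1 -> partial (gap c a) [set y].
Proof.
move=> cK ac yg cy; have [yK ay yc] := gapP _ _ _ yg.
have [b0 /andP[b0c ab0]|nob] := pickP (fun b : {set T} => (b \in c) && (a \proper b)).
  have [b bc [ab bmin]] : exists2 b, b \in c & a \proper b /\
      {in c, forall b' : {set T}, a \proper b' -> b \subset b'}.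
    have P0 : (b0 \in c) && (a \proper b0) by rewrite b0c.
    case: (@arg_minnP _ b0 (fun b : {set T} => (b \in c) && (a \proper b)) (fun b : {set T} => #|b|) P0).
    move=> b /andP[bc ab] bmin; exists b => //; split=> // b' b'c ab'.
    have [//|b'b] := sd_chain cK (setU1r _ bc) (setU1r _ b'c).
    have /eqP-> // : b' == b; rewrite eqEcard b'b bmin // b'c; exact: ab'.
  have notsub b' : a \proper b' -> ~ b' \subset a.
    by move=> + h; rewrite properE h andbF.
  have -> : gap c a = [set u : {set T} | a \proper u & u \proper b].
    apply/setP=> u; rewrite [RHS]inE; apply/gapP/andP => [[uK au]|[au ub]].
      by move=> /(_ b bc) [/(notsub _ ab)//|].
    have bK : b \in K by move: cK; rewrite inE => /and3P[/subsetP->].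
    split=> //; first exact: K_complex bK (proper_sub ub).
    move=> b' b'c; have [/eqP e|nab'] := boolP (a == b').
      by left; rewrite e.
    have [ab'|] := sd_chain cK ac (setU1r _ b'c); last by left.
    right; apply: proper_sub_trans ub (bmin _ b'c _).
    by rewrite properEneq nab'.
  apply: vertex_partial_simplex => //.
  by have [/(notsub _ ab)|] := yc b bc.
have -> : gap c a = [set u in K | a \proper u].
  apply/setP=> u; rewrite [RHS]inE; apply/gapP/andP => [[]//|[uK au]].
  split=> // b bc; left; have [ab|//] := sd_chain cK ac (setU1r _ bc).
  have := nob b; rewrite bc properEneq ab andbT /= => /negbFE/eqP->.
  by [].
exact: vertex_partial_link.
Qed.

(** * Faces comparable to a chain, and links in the subdivision *)

Definition around c := [set u in K | [&& u != set0, u \notin c &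
  [forall b in c, (b \subset u) || (u \subset b)]]].

(** The gap of [u] starts at the largest member of [set0 |: c] properly contained in [u]. *)
Lemma aroundP c u : c \in sd K ->
  reflect (exists2 a, a \in set0 |: c & u \in gap c a) (u \in around c).
Proof.
move=> cK; apply: (iffP idP) => [|[a ac /gapP[uK au uc]]]; last first.
  rewrite inE uK /=; apply/and3P; split.
  - by apply: contraTneq au => ->; rewrite properE sub0set andbF.
  - apply/negP => /uc[ua|]; last by rewrite properxx.
    by move: au; rewrite properE ua andbF.
  apply/forall_inP => b /uc[ba|/proper_sub->]; last by rewrite orbT.
  by rewrite (subset_trans ba (proper_sub au)).
rewrite inE => /and4P[uK u0 uc /forall_inP ucomp].
have P0 : (set0 \in set0 |: c) && (set0 \proper u) by rewrite setU11 proper0.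
case: (@arg_maxnP _ set0 (fun b : {set T} => (b \in set0 |: c) && (b \proper u))
  (fun b : {set T} => #|b|) P0).
move=> a /andP[ac au] amax; exists a => //; apply/gapP; split=> // b bc.
have bu : b != u by apply: contraNneq uc => <-.
have [bu'|ub] := orP (ucomp b bc); last by right; rewrite properEneq eq_sym bu.
left; have [//|ab] := sd_chain cK (setU1r _ bc) ac.
have /eqP<- // : a == b; rewrite eqEcard ab; apply: amax.
by rewrite setU1r //= properEneq bu.
Qed.

Lemma gap_sub c a : c \in sd K -> a \in set0 |: c -> gap c a \subset around c.
Proof. by move=> cK ac; apply/subsetP=> u ug; apply/aroundP=> //; exists a. Qed.

(** If [a] were properly below [a'], then [u] would lie properly below [a'] as a face of the first
    gap and properly above it as a face of the second. *)
Lemma gap_uniq c a a' u : c \in sd K -> a \in set0 |: c -> a' \in set0 |: c ->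
  u \in gap c a -> u \in gap c a' -> a = a'.
Proof.
move=> cK ac a'c /gapP[_ au uc] /gapP[_ a'u uc'].
wlog aa' : a a' ac a'c au uc a'u uc' / a \subset a'.
  by move=> H; have [h|h] := sd_chain cK ac a'c; [|symmetry]; apply: H.
case/setU1P: a'c aa' => [->|a'c aa']; first by rewrite subset0 => /eqP.
have [a'a|] := uc _ a'c; first by apply/eqP; rewrite eqEsubset aa'.
by move/(proper_trans a'u); rewrite properxx.
Qed.

Lemma sd_setU1 c w : c \in sd K -> w \in around c -> w |: c \in sd K.
Proof.
rewrite !inE => /and3P[cK c0 /forall_inP ch] /and4P[wK w0 _ /forall_inP wc].
rewrite subUset sub1set wK cK negb_or eq_sym w0 c0 /=.
apply/forall_inP => s; rewrite !inE => /orP[/eqP->|sc];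
  apply/forall_inP => t; rewrite !inE => /orP[/eqP->|tc]; rewrite ?subxx //.
- by rewrite orbC wc.
- exact: wc.
- by have /forall_inP := ch s sc; apply.
Qed.

Lemma around_setU1 c w u : (u \in around (w |: c)) =
  [&& u \in around c, u != w & (w \subset u) || (u \subset w)].
Proof.
rewrite !inE negb_or; apply/idP/idP.
  case/and4P=> -> -> /andP[-> ->] /forall_inP h; rewrite /= h ?setU11 // andbT.
  by apply/forall_inP => b bc; apply: h; rewrite setU1r.
case/and3P=> /and4P[-> -> -> /forall_inP h] -> wu; apply/forall_inP => b.
by rewrite !inE => /orP[/eqP->//|/h].
Qed.

Lemma vertices_sd_around c : vertices (sd (around c)) = around c.
Proof.
apply/setP=> u; rewrite !inE sub1set inE; apply/idP/idP => [/andP[]//|].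
move=> /[dup] h /and4P[_ u0 _ _]; rewrite h eq_sym u0 /=.
apply/forall_inP => s /set1P->; apply/forall_inP => t /set1P->.
by rewrite subxx.
Qed.

(** A chain belongs to the link of [w] when its members differ from [w] and are comparable to it.
    The complexes [sd (around c)] are thus closed under links of vertices. *)
Lemma link_sd_around c w : c \in sd K -> w \in around c ->
  link [set w] (sd (around c)) = sd (around (w |: c)).
Proof.
move=> cK wc; apply/setP=> S; rewrite in_link disjoint_sym disjoints1 setUC.
apply/idP/idP.
  rewrite !inE !subUset sub1set wc /= => /and4P[wS Sc].
  rewrite negb_or => /andP[_ S0] /forall_inP ch.
  apply/and3P; split=> //.
    apply/subsetP=> s sS; rewrite around_setU1 (subsetP Sc) //=.
    apply/andP; split; first by apply: contraNneq wS => <-.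
    by have /forall_inP := ch w (setU11 _ _); apply; rewrite setU1r.
  apply/forall_inP => s sS; apply/forall_inP => t tS.
  by have /forall_inP := ch s (setU1r _ sS); apply; rewrite setU1r.
rewrite [S \in sd _]inE => /and3P[/subsetP Sw S0 /forall_inP ch].
have wS : w \notin S by apply/negP => /Sw; rewrite around_setU1 eqxx andbF.
rewrite wS inE subUset sub1set wc !inE negb_or S0 /=; apply/and3P; split.
- by apply/subsetP => s /Sw; rewrite around_setU1 => /andP[].
- by rewrite andbT; move: wc; rewrite inE eq_sym => /and4P[].
apply/forall_inP => s; rewrite !inE => /orP[/eqP->|sS];
  apply/forall_inP => t; rewrite !inE => /orP[/eqP->|tS]; rewrite ?subxx //.
- by have := Sw _ tS; rewrite around_setU1 => /and3P[].
- by have := Sw _ sS; rewrite around_setU1 orbC => /and3P[].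
- by have /forall_inP := ch s sS; apply.
Qed.

(** * Splitting of a gap by a new member of the chain *)

Section GapSplit.

Variables (c : {set {set T}}) (a w : {set T}).
Hypotheses (cK : c \in sd K) (ac : a \in set0 |: c) (wa : w \in gap c a).

Lemma gap_other a' : a' \in set0 |: c -> a' != a -> gap (w |: c) a' = gap c a'.
Proof.
move=> a'c a'a; have [_ aw wc] := gapP _ _ _ wa.
apply/setP=> u; apply/gapP/gapP => -[uK a'u h]; split=> // b.
  by move=> bc; apply: h; rewrite setU1r.
case/setU1P=> [->|]; last exact: h.
have notsub (s t : {set T}) : s \subset t -> t \subset s -> s = t.
  by move=> st ts; apply/eqP; rewrite eqEsubset st.
have [aa'|a'a'] := sd_chain cK ac a'c.
  case/setU1P: a'c => [e|a'c].
    by move: aa' a'a; rewrite e subset0 eq_sym => ->.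
  have [h'|/proper_sub] := wc _ a'c; last by left.
  by rewrite (notsub _ _ aa' h') eqxx in a'a.
case/setU1P: ac => [e|ac'].
  by move: a'a' a'a; rewrite e subset0 => ->.
have [h'|ua] := h _ ac'; first by rewrite (notsub _ _ a'a' h') eqxx in a'a.
by right; apply: proper_trans aw.
Qed.

Lemma in_gap_lower u : (u \in gap (w |: c) a) = (u \in gap c a) && (u \proper w).
Proof.
have [_ aw wc] := gapP _ _ _ wa.
apply/gapP/andP => [[uK au h]|[/gapP[uK au h] uw]].
  split; first by apply/gapP; split=> // b bc; apply: h; rewrite setU1r.
  have [wa'|//] := h _ (setU11 _ _).
  by move: aw; rewrite properE wa' andbF.
by split=> // b /setU1P[->|]; [right | apply: h].
Qed.

Lemma in_gap_upper u : (u \in gap (w |: c) w) = (u \in gap c a) && (w \proper u).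
Proof.
have [_ aw wc] := gapP _ _ _ wa.
apply/gapP/andP => [[uK wu h]|[/gapP[uK au h] wu]].
  split=> //; apply/gapP; split=> //; first exact: proper_trans wu.
  move=> b bc; have [bw|] := h _ (setU1r _ bc); last by right.
  have [|wb] := wc _ bc; first by left.
  by move: wb; rewrite properE bw andbF.
split=> // b /setU1P[->|bc]; first by left.
by have [ba|] := h _ bc; [left; rewrite (subset_trans ba) ?proper_sub | right].
Qed.

(** The chain drops out of the description, since every member of [c] is contained in [a] or
    properly contains [w]. *)
Lemma gap_lower_simplex :
  gap (w |: c) a = [set u : {set T} | a \proper u & u \proper w].
Proof.
have [wK aw wc] := gapP _ _ _ wa.
apply/setP=> u; rewrite in_gap_lower [RHS]inE.
apply/andP/andP => -[h uw]; split=> //; first by case/gapP: h.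
apply/gapP; split=> //; first by apply: K_complex wK (proper_sub uw).
move=> b /wc[|wb]; first by left.
by right; apply: proper_trans wb.
Qed.

End GapSplit.


(** * Purity and dimension of links in the subdivision *)

Lemma sd_complex (F : {set {set T}}) : simplicial_complex (sd F).
Proof.
move=> S R; rewrite !inE => /and3P[SF S0 /forall_inP ch] RS.
rewrite (subset_trans RS SF) (contra (subsetP RS set0) S0) /=.
apply/forall_inP => s sR; apply/forall_inP => t tR.
by have /forall_inP := ch s (subsetP RS _ sR); apply; apply: (subsetP RS).
Qed.

Lemma intermediate_set a b m : a \subset b -> #|a| <= m <= #|b| ->
  exists u, [/\ a \subset u, u \subset b & #|u| = m].
Proof.
move=> ab /andP[am mb]; pose s := take (m - #|a|) (enum (b :\: a)).
have sba x : x \in s -> x \in b :\: a by move/mem_take; rewrite mem_enum.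
exists (a :|: [set:: s]); split; first exact: subsetUl.
  rewrite subUset ab; apply/subsetP => x; rewrite inE => /sba.
  by rewrite inE => /andP[].
have -> : #|a :|: [set:: s]| = #|a| + #|[set:: s]|.
  apply/eqP; rewrite leq_card_setU disjoint_sym disjoints_subset.
  by apply/subsetP => x; rewrite inE => /sba; rewrite !inE => /andP[].
rewrite cardsE (card_uniqP _) ?take_uniq ?enum_uniq // size_takel.
  by rewrite subnKC.
by rewrite -cardE cardsDS // leq_sub2r.
Qed.

(** The cardinalities in a maximal chain are exactly 1 to [n]: if [m] were missing, a face of
    cardinality [m] could be inserted. *)
Lemma sd_facet_card S : set0 \in K -> S \in facets (sd K) -> #|S| = n.
Proof.
move=> K0; rewrite inE => /maxsetP[SK Smax].
have {}SK : S \in sd K := SK.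
have chS := @sd_chain S _ _ SK.
have SinK s : s \in S -> s \in K by move: SK; rewrite inE => /and3P[/subsetP h _ _] /h.
have S0 s : s \in S -> 0 < #|s|.
  by rewrite card_gt0; move: SK; rewrite inE => /and3P[_ S0 _] sS; apply: contraNneq S0 => <-.
rewrite cardE -(size_map (fun s : {set T} => #|s|)) -(size_iota 1 n).
apply/perm_size/uniq_perm; rewrite ?iota_uniq //.
  rewrite map_inj_in_uniq ?enum_uniq // => s t; rewrite !mem_enum => sS tS /= e.
  have [h|h] := chS _ _ (setU1r _ sS) (setU1r _ tS); apply/eqP.
    by rewrite eqEcard h e /= leqnn.
  by rewrite eq_sym eqEcard h e /= leqnn.
move=> m; rewrite mem_iota add1n ltnS; apply/mapP/idP => [[s]|/andP[m0 mn]].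
  by rewrite mem_enum => sS ->; rewrite S0 // card_le_n // SinK.
have [s /andP[sS /eqP sm]|noS] := pickP [pred s in S | #|s| == m].
  by exists s; rewrite ?mem_enum.
have {}noS s : s \in S -> #|s| != m.
  by move=> sS; have := noS s; rewrite /= sS /= => ->.
have [a [aS am amax]] : exists a, [/\ a \in set0 |: S, #|a| < m &
    {in S, forall s : {set T}, #|s| < m -> s \subset a}].
  have P0 : (set0 \in set0 |: S) && (#|@set0 T| < m) by rewrite setU11 cards0.
  case: (@arg_maxnP _ set0 (fun s : {set T} => (s \in set0 |: S) && (#|s| < m))
    (fun s : {set T} => #|s|) P0) => a /andP[aS am] amax.
  exists a; split=> // s sS sm; have [//|as_] := chS _ _ (setU1r _ sS) aS.
  have /eqP<- // : a == s; rewrite eqEcard as_; apply: amax.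
  by rewrite setU1r.
have aK : a \in K by case/setU1P: aS => [->|/SinK].
(* The smallest member above the missing cardinality or, if there is none, a facet containing
   [a]. *)
have [b [bK ab mb bmin]] : exists b, [/\ b \in K, a \subset b, m <= #|b| &
    {in S, forall s : {set T}, m < #|s| -> b \subset s}].
  have [s0 P0|big] := pickP [pred s in S | m < #|s|].
    case: (@arg_minnP _ s0 (fun s : {set T} => (s \in S) && (m < #|s|))
      (fun s : {set T} => #|s|) P0) => b /andP[bS mb] bmin.
    exists b; split=> //; [exact: SinK | | exact: ltnW |].
      have [//|/subset_leq_card h] := chS _ _ aS (setU1r _ bS).
      by have := leq_trans (leq_ltn_trans h am) (ltnW mb); rewrite ltnn.
    move=> s sS ms; have [//|sb] := chS _ _ (setU1r _ bS) (setU1r _ sS).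
    have /eqP<- // : s == b; rewrite eqEcard sb; apply: bmin.
    by rewrite sS.
  have [b /[dup] bF /maxsetP[bK _] ab] := @maxset_exists _ (mem K) a aK.
  exists b; split=> //; first by rewrite (_ : #|b| = n) //; apply: K_facets; rewrite inE.
  by move=> s sS ms; have := big s; rewrite /= sS ms.
have [u [au ub um]] : exists u, [/\ a \subset u, u \subset b & #|u| = m].
  by apply: intermediate_set; rewrite // (ltnW am).
have uS : u \notin S by apply/negP => /noS; rewrite um eqxx.
have ucomp s : s \in S -> (s \subset u) || (u \subset s).
  move=> sS; have := noS s sS; case: ltngtP => // h _.
    by rewrite (subset_trans (amax s sS h) au).
  by rewrite (subset_trans ub (bmin s sS h)) orbT.
have : u |: S \in sd K.
  move: SK; rewrite !inE => /and3P[SK S00 /forall_inP ch].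
  rewrite subUset sub1set SK (K_complex bK ub) negb_or S00 andbT /=.
  rewrite eq_sym -card_gt0 um m0 /=.
  apply/forall_inP => s; rewrite !inE => /orP[/eqP->|sS];
    apply/forall_inP => t; rewrite !inE => /orP[/eqP->|tS]; rewrite ?subxx //.
  - by rewrite orbC ucomp.
  - exact: ucomp.
  - by have /forall_inP := ch s sS; apply.
move=> /(Smax _)/(_ (subsetUr _ _)) e.
by move: uS; rewrite -e setU11.
Qed.

(** Adjoining [c] to [S] gives a maximal chain of [K]: a larger chain, once [c] is removed, lies in
    [around c], and the maximality of [S] applies. *)
Lemma sd_around_facet_card c S : set0 \in K -> c \in sd K ->
  S \in facets (sd (around c)) -> #|S| + #|c| = n.
Proof.
move=> K0 cK; rewrite inE => /maxsetP[SQ Smax]; have {}SQ : S \in sd (around c) := SQ.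
have union (R : {set {set T}}) : R \in sd (around c) -> R :|: c \in sd K.
  move: (cK); rewrite !inE => /and3P[cK' c0 /forall_inP cch].
  move=> /and3P[/subsetP RQ R0 /forall_inP Rch].
  rewrite subUset cK' negb_or R0 c0 !andbT /=; apply/andP; split.
    by apply/subsetP => r /RQ; rewrite inE => /andP[].
  have Rc (r b : {set T}) : r \in R -> b \in c -> (b \subset r) || (r \subset b).
    by move=> /RQ; rewrite inE => /and4P[_ _ _ /forall_inP]; apply.
  apply/forall_inP => s /setUP[sR|sc]; apply/forall_inP => t /setUP[tR|tc].
  - by have /forall_inP := Rch s sR; apply.
  - by rewrite orbC Rc.
  - exact: Rc.
  - by have /forall_inP := cch s sc; apply.
have dis (R : {set {set T}}) : R \subset around c -> [disjoint R & c].
  move=> /subsetP RQ; rewrite disjoints_subset; apply/subsetP => r /RQ.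
  by rewrite !inE => /and4P[].
have sdQ (R : {set {set T}}) : R \in sd (around c) -> R \subset around c.
  by rewrite inE => /and3P[].
have -> : #|S| + #|c| = #|S :|: c|.
  by apply/esym/eqP; rewrite leq_card_setU dis ?sdQ.
apply: sd_facet_card => //; rewrite inE; apply/maxsetP; split.
  exact: union.
move=> R RK SR; have {}RK : R \in sd K := RK.
have RD : R :\: c \in sd (around c).
  move: RK; rewrite [R \in _]inE => /and3P[/subsetP RK R0 /forall_inP Rch].
  rewrite inE; apply/and3P; split.
  - apply/subsetP => r; rewrite inE => /andP[rc rR].
    rewrite inE RK //= rc /=; apply/andP; split.
      by apply: contraNneq R0 => <-.
    apply/forall_inP => b bc.
    have bR : b \in R by rewrite (subsetP SR) // inE bc orbT.
    by have /forall_inP := Rch b bR; apply.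
  - by rewrite inE negb_and R0 orbT.
  apply/forall_inP => s /setDP[sR _]; apply/forall_inP => t /setDP[tR _].
  by have /forall_inP := Rch s sR; apply.
have SR' : S \subset R :\: c.
  by rewrite subsetD (subset_trans (subsetUl _ _) SR) dis ?sdQ.
rewrite -(Smax _ RD SR'); apply/setP => r; rewrite !inE.
have [rc|//] := boolP (r \in c); last by rewrite orbF.
by rewrite (subsetP SR) // inE rc orbT.
Qed.

(** The truncated subtraction is exact: a facet of [sd (around c)] exists, and its cardinality and
    that of [c] add up to [n]. *)
Lemma sd_around_dim c : set0 \in K -> c \in sd K ->
  pure (sd (around c)) /\ has_dim (sd (around c)) ((n - #|c|)%N%:Z - 1)%R.
Proof.
move=> K0 cK; have card (S : {set {set T}}) : S \in facets (sd (around c)) -> #|S| = n - #|c|.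
  by move=> /sd_around_facet_card<- //; rewrite addnK.
have ex (S : {set {set T}}) : S \in sd (around c) ->
    exists2 R, R \in facets (sd (around c)) & S \subset R.
  move=> SQ; have [R RF SR] := @maxset_exists _ (mem (sd (around c))) S SQ.
  by exists R; rewrite ?inE.
split; first by move=> S R SF RF; rewrite /face_dim (card _ SF) (card _ RF).
have S0 : set0 \in sd (around c).
  rewrite inE sub0set inE /=; apply/forall_inP => s; rewrite inE //.
split.
  have [R RF _] := ex _ S0; exists R; last by rewrite /face_dim (card _ RF).
  by move: RF; rewrite inE => /maxsetP[].
move=> S /ex[R RF /subset_leq_card]; rewrite (card _ RF) /face_dim; lia.
Qed.


(** * Initial parts that are stable under passing to links *)

Definition other_gaps c a A := {in set0 |: c, forall a', a' != a ->
  gap_state (gap c a') (A :&: gap c a')}.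

(** Such a gap survives unchanged in the link of any face of the gap of [a], and there provides the
    partial trace that [good] asks for. *)
Definition helped c a A := exists a',
  [/\ a' \in set0 |: c, a' != a & partial (gap c a') (A :&: gap c a')].

Definition good c A := A = around c \/
  {in set0 |: c, forall a, gap_state (gap c a) (A :&: gap c a)} /\
  exists2 a, a \in set0 |: c & partial (gap c a) (A :&: gap c a).

Lemma gap_disjoint c a a' A : c \in sd K -> a \in set0 |: c ->
  a' \in set0 |: c -> a' != a -> A \subset gap c a -> A :&: gap c a' = set0.
Proof.
move=> cK ac a'c /eqP a'a /subsetP Aa; apply/setP=> u; rewrite in_setI in_set0.
apply/negP => /andP[/Aa ua ua']; apply: a'a.
exact: gap_uniq cK a'c ac ua' ua.
Qed.

(** * Growing an initial part, given the result for links *)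

Section Extend.

Variable c : {set {set T}}.
Hypothesis cK : c \in sd K.
Let X := sd (around c).
Hypothesis IH : forall w A, w \in around c -> A \subset around (w |: c) ->
  good (w |: c) A -> star_decomposable (sd (sd (around (w |: c)))) A.

Lemma reach_good A w : w \in around c -> w \notin A ->
  good (w |: c) (A :&: around (w |: c)) -> reach X A (w |: A).
Proof.
move=> wc wA wgood; apply: reach_add1 => //; first by rewrite vertices_sd_around.
rewrite link_sd_around // vertices_sd_around.
by apply: IH => //; apply: subsetIr.
Qed.

Lemma around_gap_setI A w a : w \in around c -> a \in set0 |: (w |: c) ->
  A :&: around (w |: c) :&: gap (w |: c) a = A :&: gap (w |: c) a.
Proof.
by move=> wc ac; rewrite -setIA (setIidPr (gap_sub _ ac)) ?sd_setU1.
Qed.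

(** In the link of [w], the gap of [a] is replaced by its parts below and above [w], and the other
    gaps stay the same. *)
Lemma reach_gap_good a w A : a \in set0 |: c -> w \in gap c a -> w \notin A ->
    other_gaps c a A ->
    gap_state (gap (w |: c) a) (A :&: gap (w |: c) a) ->
    gap_state (gap (w |: c) w) (A :&: gap (w |: c) w) ->
    [\/ partial (gap (w |: c) a) (A :&: gap (w |: c) a),
        partial (gap (w |: c) w) (A :&: gap (w |: c) w) | helped c a A] ->
  reach X A (w |: A).
Proof.
move=> ac wa wA oth lo up h; have wc : w \in around c by apply/aroundP => //; exists a.
apply: reach_good => //; right.
have sub a' : a' \in set0 |: c -> a' \in set0 |: (w |: c).
  by rewrite setUCA => ?; rewrite setU1r.
have ww : w \in set0 |: (w |: c) by rewrite setUCA setU11.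
split.
  move=> a'; rewrite setUCA => /setU1P[->|a'c].
    by rewrite around_gap_setI.
  rewrite (around_gap_setI _ wc (sub _ a'c)).
  have [-> //|a'a] := eqVneq a' a.
  by rewrite (gap_other cK ac wa) //; apply: oth.
case: h => [h|h|[a' [a'c a'a h]]].
- by exists a; rewrite ?(around_gap_setI _ wc) ?(sub _ ac).
- by exists w => //; rewrite around_gap_setI.
- exists a'; first exact: sub.
  by rewrite (around_gap_setI _ wc (sub _ a'c)) (gap_other cK ac wa).
Qed.

Lemma other_gapsU a A L : a \in set0 |: c -> L \subset gap c a ->
  other_gaps c a A -> other_gaps c a (A :|: L).
Proof.
move=> ac La oth a' a'c a'a; rewrite setIUl (gap_disjoint cK ac a'c a'a La) setU0.
exact: oth.
Qed.

Lemma helpedU a A L : a \in set0 |: c -> L \subset gap c a ->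
  helped c a A -> helped c a (A :|: L).
Proof.
move=> ac La [a' [a'c a'a h]]; exists a'; split=> //.
by rewrite setIUl (gap_disjoint cK ac a'c a'a La) setU0.
Qed.

(* In the link of [t] the sets present below [t] form the boundary of a simplex
   minus the facet [s]; afterwards, in the link of [s], the whole boundary
   below [s] and the single vertex [t] above it are present. *)
Lemma expands_reach a A L : a \in set0 |: c -> other_gaps c a A ->
  expands (gap c a) (A :&: gap c a) L -> reach X A (A :|: L).
Proof.
move=> ac oth; elim=> [|L1 s t AL1 IH1 sE tE sL1 tL1 st ct below nocof].
  by rewrite (setUidPl (subsetIl _ _)); apply: reach_refl.
have L1E := expands_subE (subsetIr _ _) AL1.
have in_gap u : u \in gap c a -> (u \in A :|: L1) = (u \in L1).
  move=> uE; rewrite inE orb_idl // => uA.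
  by apply: (subsetP (expands_sub AL1)); rewrite inE uA.
apply: reach_trans IH1 _.
have oth1 := other_gapsU ac L1E oth.
have tA : t \notin A :|: L1 by rewrite in_gap.
have [_ as_ _] := gapP _ _ _ sE; have [_ at_ _] := gapP _ _ _ tE.
have Rt : reach X (A :|: L1) (t |: (A :|: L1)).
  have lo : partial (gap (t |: c) a) ((A :|: L1) :&: gap (t |: c) a).
    rewrite (gap_lower_simplex tE).
    suff -> : (A :|: L1) :&: [set u : {set T} | a \proper u & u \proper t] =
        [set u : {set T} | a \proper u & u \proper t] :\ s.
      exact: facet_removed_partial.
    rewrite -(gap_lower_simplex tE).
    apply/setP=> u; rewrite in_setI in_setD1 (in_gap_lower tE).
    have [uE|] := boolP (u \in gap c a); last by rewrite /= !andbF.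
    rewrite in_gap //; have [->|us] := eqVneq u s.
      by rewrite (negPf sL1).
    have [ut /=|] := boolP (u \proper t); last by rewrite /= !andbF.
    by rewrite below.
  apply: (reach_gap_good ac tE) => //; [by constructor 2 | | by constructor 1].
  constructor 1; apply/setP=> u; rewrite in_setI (in_gap_upper tE) in_set0.
  have [uE /=|] := boolP (u \in gap c a); last by rewrite /= ?andbF.
  rewrite in_gap //; apply/andP => -[uL1 tu].
  by have := nocof u uL1; rewrite (proper_trans st tu).
apply: reach_trans Rt _.
have -> : A :|: (s |: (t |: L1)) = s |: (t |: (A :|: L1)).
  by rewrite (setUCA A [set s]) (setUCA A [set t]).
have oth2 : other_gaps c a (t |: (A :|: L1)).
  by rewrite setUC; apply: other_gapsU => //; rewrite sub1set.
have sc : s \in around c by apply/aroundP => //; exists a.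
have up : partial (gap (s |: c) s) ((t |: (A :|: L1)) :&: gap (s |: c) s).
  have tg : t \in gap (s |: c) s by rewrite (in_gap_upper sE) tE.
  suff -> : (t |: (A :|: L1)) :&: gap (s |: c) s = [set t].
    apply: vertex_partial => //; first exact: sd_setU1.
    by rewrite setUCA setU11.
  apply/setP=> u; rewrite in_setI in_setU1 in_set1.
  have [->|ut /=] := eqVneq u t; first by rewrite tg.
  rewrite (in_gap_upper sE); have [uE /=|] := boolP (u \in gap c a); last by rewrite /= ?andbF.
  by rewrite in_gap //; apply/negP => /andP[/nocof/negPf->].
apply: (reach_gap_good ac sE) => //; last by constructor 2.
- rewrite in_setU1 negb_or in_gap // sL1 andbT.
  by apply: contraTneq st => ->; rewrite properxx.
- constructor 3; apply/setIidPr/subsetP => u; rewrite (in_gap_lower sE) => /andP[uE us].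
  rewrite in_setU1 in_gap // below ?orbT //; first exact: proper_trans st.
  by apply: contraTneq us => ->; rewrite properxx.
- by constructor 2.
Qed.

(** Both parts of the split gap are empty in the link of [y], so the partial trace has to come from
    another gap. *)
Lemma vertex_reach a A y : a \in set0 |: c -> other_gaps c a A ->
  helped c a A -> A :&: gap c a = set0 -> y \in gap c a -> reach X A (y |: A).
Proof.
move=> ac oth hlp A0 yE.
have yA : y \notin A.
  apply/negP => yA; have : y \in A :&: gap c a by rewrite in_setI yA.
  by rewrite A0 in_set0.
apply: (reach_gap_good ac yE) => //; last by constructor 3.
  constructor 1; apply/eqP; rewrite -subset0 -A0; apply/subsetP => u.
  by rewrite !in_setI (in_gap_lower yE) => /and3P[-> ->].
constructor 1; apply/eqP; rewrite -subset0 -A0; apply/subsetP => u.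
by rewrite !in_setI (in_gap_upper yE) => /and3P[-> ->].
Qed.

(** The missing faces are maximal in the gap and can be added in any order: in the link of each,
    everything below it is present and the part of the gap above it is empty. *)
Lemma facets_reach a A : a \in set0 |: c -> other_gaps c a A ->
    helped c a A \/ {in set0 |: c, forall a', a' != a -> gap c a' \subset A} ->
    {in gap c a :\: A & gap c a, forall s u : {set T}, ~~ (s \proper u)} ->
  reach X A (A :|: gap c a).
Proof.
move=> ac oth hlp; have [m] := ubnP #|gap c a :\: A|.
elim: m A oth hlp => // m IHm A oth hlp cm top.
have [e|[s sEA]] := set_0Vmem (gap c a :\: A).
  have /setUidPl-> : gap c a \subset A by rewrite -setD_eq0 e.
  exact: reach_refl.
have [sE sA] := setDP sEA; have sc : s \in around c by apply/aroundP => //; exists a.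
have lo : gap (s |: c) a \subset A.
  apply/subsetP => u; rewrite (in_gap_lower sE) => /andP[uE us].
  by apply: contraT => uA; have := top u s; rewrite us; apply; rewrite // inE uA.
have up : gap (s |: c) s = set0.
  apply/setP => u; rewrite (in_gap_upper sE) in_set0; apply/negP => /andP[uE].
  by apply/negP/top.
have Rs : reach X A (s |: A).
  case: hlp => [hlp|full].
    apply: (reach_gap_good ac sE) => //; last by constructor 3.
      by constructor 3; apply/setIidPr.
    by constructor 1; rewrite up setI0.
  (* With the other gaps full, the whole link of [s] is present. *)
  apply: reach_good => //; left; apply/setIidPr/subsetP => u.
  move=> /(aroundP _ (sd_setU1 cK sc))[a']; rewrite setUCA => /setU1P[->|a'c].
    by rewrite up inE.
  have [->|a'a] := eqVneq a' a; first exact: (subsetP lo).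
  by rewrite (gap_other cK ac sE) //; apply/subsetP/full.
have -> : A :|: gap c a = (s |: A) :|: gap c a.
  have /setUidPr e : [set s] \subset gap c a by rewrite sub1set.
  by rewrite -setUA setUCA e.
apply: reach_trans Rs _; apply: IHm.
- by rewrite setUC; apply: other_gapsU => //; rewrite sub1set.
- case: hlp => [hlp|full]; [left | right].
    by rewrite setUC; apply: helpedU => //; rewrite sub1set.
  by move=> a' a'c a'a; rewrite (subset_trans (full _ a'c a'a)) ?subsetUr.
- rewrite -ltnS; apply: leq_trans cm; rewrite ltnS; apply: proper_card.
  rewrite properE setDS ?subsetUr //=; apply/subsetPn; exists s => //.
  by rewrite !inE eqxx.
- move=> t u; rewrite in_setD in_setU1 negb_or -andbA => /and3P[_ tA tE] uE.
  by apply: top; rewrite // in_setD tA.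
Qed.

(** The anti-collapse is run to its end, then the sets removed by [F] are added. *)
Lemma partial_reach a A : a \in set0 |: c -> other_gaps c a A ->
    helped c a A \/ {in set0 |: c, forall a', a' != a -> gap c a' \subset A} ->
    partial (gap c a) (A :&: gap c a) ->
  reach X A (A :|: gap c a).
Proof.
move=> ac oth hlp [y [F [_ Ftop _ AF]]].
have -> : A :|: gap c a = (A :|: (gap c a :\: F)) :|: gap c a.
  by rewrite -setUA (setUidPr (subsetDl _ _)).
apply: reach_trans (expands_reach ac oth AF) _; apply: facets_reach => //.
- exact: other_gapsU (subsetDl _ _) _.
- case: hlp => [hlp|full]; [left; exact: helpedU (subsetDl _ _) _| right].
  by move=> a' a'c a'a; rewrite (subset_trans (full _ a'c a'a)) ?subsetUl.
move=> s u; rewrite in_setD in_setU in_setD => /andP[/norP[_ h] sE].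
by apply: Ftop; move: h; rewrite sE andbT negbK.
Qed.

Lemma gap_vertex a w : w \in gap c a -> exists2 y, y \in gap c a & #|y| = #|a|.+1.
Proof.
move=> /gapP[wK aw wc]; have [sa [p pw pa]] := properP aw.
have yw : p |: a \subset w by rewrite subUset sub1set pw.
exists (p |: a); last by rewrite cardsU1 pa.
apply/gapP; split; first exact: K_complex wK yw.
  by rewrite properUr ?sub1set.
by move=> b /wc[|wb]; [left | right; apply: sub_proper_trans wb].
Qed.

(** An empty gap receives its first face with the help of another partial gap; from then on its own
    anti-collapse continues by itself. *)
Lemma gap_reach a A L : a \in set0 |: c -> other_gaps c a A -> helped c a A ->
    gap_state (gap c a) (A :&: gap c a) -> gap_state (gap c a) L ->
    [\/ L = A :&: gap c a, A :&: gap c a = set0 | L = gap c a] ->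
  reach X A (A :|: L).
Proof.
move=> ac oth hlp Ast Lst AL.
have refl (M : {set {set T}}) : M \subset A -> reach X A (A :|: M).
  by move=> /setUidPl->; apply: reach_refl.
have from_vertex y (M : {set {set T}}) : A :&: gap c a = set0 -> y \in gap c a ->
    (reach X (A :|: [set y]) (A :|: [set y] :|: M)) ->
    y \in M -> reach X A (A :|: M).
  move=> A0 yE R yM; have := vertex_reach ac oth hlp A0 yE.
  rewrite setUC => /reach_trans/(_ R); rewrite -setUA.
  by have /setUidPr-> : [set y] \subset M by rewrite sub1set.
have othy y : y \in gap c a -> other_gaps c a (A :|: [set y]).
  by move=> yE; apply: other_gapsU => //; rewrite sub1set.
have hlpy y : y \in gap c a -> helped c a (A :|: [set y]).
  by move=> yE; apply: helpedU => //; rewrite sub1set.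
have Ay y : A :&: gap c a = set0 -> y \in gap c a ->
    (A :|: [set y]) :&: gap c a = [set y].
  by move=> A0 yE; rewrite setIUl A0 set0U; apply/setIidPl; rewrite sub1set.
have fill : A :&: gap c a = set0 -> reach X A (A :|: gap c a).
  move=> A0; have [->|[w wE]] := set_0Vmem (gap c a).
    by rewrite setU0; apply: reach_refl.
  have [y yE cy] := gap_vertex wE; apply: (from_vertex y) => //.
  apply: partial_reach => //; [exact: othy | by left; apply: hlpy |].
  by rewrite Ay //; apply: vertex_partial.
case: AL => [->|A0|->]; first exact: refl (subsetIl _ _).
  case: Lst => [->|[y [F [yE Ftop yL _]]]|->]; last exact: fill.
    exact: refl (sub0set _).
  apply: (from_vertex y) => //; last by apply: (subsetP (expands_sub yL)); rewrite inE.
  by apply: (expands_reach ac); rewrite ?Ay //; apply: othy.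
case: Ast => [/fill //|Ap|/setIidPr]; last exact: refl.
by apply: partial_reach => //; left.
Qed.

(** The gap of [g] remains partial throughout and helps the other gaps, which are treated one after
    another. *)
Lemma states_reach g A (B : {set {set T}}) : g \in set0 |: c -> A \subset B ->
    B \subset around c ->
    {in set0 |: c, forall a, gap_state (gap c a) (A :&: gap c a)} ->
    {in set0 |: c, forall a, gap_state (gap c a) (B :&: gap c a)} ->
    partial (gap c g) (A :&: gap c g) -> A :&: gap c g = B :&: gap c g ->
    {in set0 |: c, forall a, [\/ B :&: gap c a = A :&: gap c a,
       A :&: gap c a = set0 | B :&: gap c a = gap c a]} ->
  reach X A B.
Proof.
move=> gc + Bc; have [m] := ubnP #|B :\: A|.
elim: m A => // m IHm A cm AB Ast Bst Ag ABg AB_.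
have [e|[w wBA]] := set_0Vmem (B :\: A).
  have -> : B = A by apply/eqP; rewrite eqEsubset AB -setD_eq0 e eqxx.
  exact: reach_refl.
have [wB wA] := setDP wBA.
have [a ac wa] := aroundP _ cK (subsetP Bc _ wB).
have ag : g != a.
  apply: contraNneq wA => e.
  have : w \in A :&: gap c g by rewrite ABg in_setI wB e.
  by rewrite in_setI => /andP[].
have step : reach X A (A :|: (B :&: gap c a)).
  apply: (gap_reach ac); [by move=> a' a'c _; apply: Ast | by exists g |
    exact: Ast | exact: Bst | exact: AB_].
have diff a' : a' \in set0 |: c -> a' != a ->
    (A :|: (B :&: gap c a)) :&: gap c a' = A :&: gap c a'.
  by move=> a'c a'a; rewrite setIUl (gap_disjoint cK ac a'c a'a (subsetIr B _)) setU0.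
have same : (A :|: (B :&: gap c a)) :&: gap c a = B :&: gap c a.
  by rewrite setIUl -setIA setIid; apply/setUidPr/setSI.
apply: reach_trans step _; apply: IHm.
- rewrite -ltnS; apply: leq_trans cm; rewrite ltnS; apply: proper_card.
  rewrite properE setDS ?subsetUl //=; apply/subsetPn; exists w => //.
  by rewrite in_setD in_setU in_setI wB wa orbT.
- by rewrite subUset AB subsetIl.
- move=> a' a'c; have [->|a'a] := eqVneq a' a; first by rewrite same; apply: Bst.
  by rewrite diff //; apply: Ast.
- exact: Bst.
- by rewrite diff.
- by rewrite diff.
- move=> a' a'c; have [->|a'a] := eqVneq a' a; first by rewrite same; constructor 1.
  by rewrite diff //; apply: AB_.
Qed.

(** The gap of [g] is built up to its trace first. While it stays partial, the other gaps get their
    traces in [A] and are then filled; it is completed last, when all others are full. *)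
Lemma partial_order (g : {set T}) A : g \in set0 |: c -> A \subset around c ->
    {in set0 |: c, forall a, gap_state (gap c a) (A :&: gap c a)} ->
    partial (gap c g) (A :&: gap c g) ->
  exists2 y, y \in A & reach X [set y] A /\ reach X A (around c).
Proof.
move=> gc Ac Ast /[dup] Ag [y [F [yE Ftop yL _]]].
have yA : y \in A.
  by have := subsetP (expands_sub yL) y (set11 _); rewrite in_setI => /andP[].
exists y => //; split.
  have y_y : [set y] :&: gap c g = [set y] by apply/setIidPl; rewrite sub1set.
  have R1 : reach X [set y] ([set y] :|: (A :&: gap c g)).
    apply: (expands_reach gc); rewrite ?y_y // => a ac ag; constructor 1.
    by apply: (gap_disjoint cK gc ac ag); rewrite sub1set.
  have /setUidPr e : [set y] \subset A :&: gap c g by rewrite sub1set in_setI yA.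
  rewrite e in R1.
  apply: reach_trans R1 _.
  have A1g : A :&: gap c g :&: gap c g = A :&: gap c g by rewrite -setIA setIid.
  have A1o a : a \in set0 |: c -> a != g -> A :&: gap c g :&: gap c a = set0.
    by move=> ac ag; apply: gap_disjoint ag (subsetIr _ _).
  apply: (states_reach gc) => //; rewrite ?A1g //; first exact: subsetIl.
    move=> a ac; have [->|ag] := eqVneq a g; first by rewrite A1g; apply: Ast.
    by rewrite A1o //; constructor 1.
  move=> a ac; have [->|ag] := eqVneq a g; first by rewrite A1g; constructor 1.
  by rewrite A1o //; constructor 2.
(* All gaps other than that of [g] are full in [B]. *)
pose B := A :|: (around c :\: gap c g).
have Bg : B :&: gap c g = A :&: gap c g.
  by rewrite setIUl setIDAC -setIDA setDv setI0 setU0.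
have Bo a : a \in set0 |: c -> a != g -> B :&: gap c a = gap c a.
  move=> ac ag; apply/setIidPr/subsetP => u ua; rewrite in_setU; apply/orP; right.
  rewrite in_setD (subsetP (gap_sub cK ac)) // andbT; apply/negP => ug.
  by rewrite (gap_uniq cK ac gc ua ug) eqxx in ag.
have Bst : {in set0 |: c, forall a, gap_state (gap c a) (B :&: gap c a)}.
  move=> a ac; have [->|ag] := eqVneq a g; first by rewrite Bg; apply: Ast.
  by rewrite Bo //; constructor 3.
have RB : reach X A B.
  apply: (states_reach gc) => //; first exact: subsetUl.
    by rewrite subUset Ac subsetDl.
  move=> a ac; have [->|ag] := eqVneq a g; first by rewrite Bg; constructor 1.
  by rewrite Bo //; constructor 3.
apply: reach_trans RB _.
have -> : around c = B :|: gap c g.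
  apply/setP=> u; rewrite !in_setU in_setD; have [ug|_] := boolP (u \in gap c g).
    by rewrite orbT (subsetP (gap_sub cK gc)).
  rewrite orbF /= orb_idl //; exact: (subsetP Ac).
apply: partial_reach => //; last by rewrite Bg.
  by move=> a ac _; apply: Bst.
by right => a ac ag; rewrite -(Bo a ac ag) subsetIl.
Qed.

End Extend.

(** Induction on the cardinality of [around c], which drops when the chain is enlarged by [w], as
    [w] itself leaves. *)
Lemma good_star_decomposable c A : set0 \in K -> c \in sd K ->
  A \subset around c -> good c A -> star_decomposable (sd (sd (around c))) A.
Proof.
move=> K0; have [m] := ubnP #|around c|; elim: m c A => // m IHm c A cm cK Ac.
have IH w (B : {set {set T}}) : w \in around c -> B \subset around (w |: c) -> good (w |: c) B ->
    star_decomposable (sd (sd (around (w |: c)))) B.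
  move=> wc; apply: IHm; last exact: sd_setU1.
  rewrite -ltnS; apply: leq_trans cm; rewrite ltnS; apply: proper_card.
  apply/properP; split; first by apply/subsetP => u; rewrite around_setU1 => /andP[].
  by exists w; rewrite // around_setU1 eqxx andbF.
move=> Agood; have [c0|[w wc]] := set_0Vmem (around c).
  have -> : A = set0 by apply/eqP; rewrite -subset0 -c0.
  (* Subdividing the void family still yields the empty chain, which leads to the base case. *)
  rewrite c0; have -> : sd (@set0 {set T}) = [set set0].
    apply/setP=> S; rewrite !inE subset0; apply/idP/idP => [/andP[]//|].
    move=> /eqP->; rewrite eqxx inE; apply/forall_inP => s; by rewrite inE.
  exact: star_decomposable_base.
have [y yc [yA AX]] : exists2 y, y \in around c &
    reach (sd (around c)) [set y] A /\ reach (sd (around c)) A (around c).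
  case: Agood => [->|[Ast [g gc Ag]]]; last first.
    by have [y yA R] := partial_order cK IH gc Ac Ast Ag; exists y; rewrite ?(subsetP Ac).
  (* When everything is present no starting point is prescribed: any vertex of a nonempty gap will
     do. *)
  have [g gc wg] := aroundP _ cK wc; have [y yg cy] := gap_vertex wg.
  have yc : y \in around c by apply: (subsetP (gap_sub cK gc)).
  have y_y : [set y] :&: gap c g = [set y] by apply/setIidPl; rewrite sub1set.
  have [|||y' + [_ R]] := @partial_order c cK IH g [set y] gc.
  - by rewrite sub1set.
  - move=> a ac; have [->|ag] := eqVneq a g.
      by rewrite y_y; constructor 2; apply: vertex_partial.
    by constructor 1; apply: (gap_disjoint cK gc ac ag); rewrite sub1set.
  - by rewrite y_y; apply: vertex_partial.
  by exists y => //; split=> //; apply: reach_refl.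
have [Xpure Xdim] := sd_around_dim K0 cK.
(* The existence of a vertex makes the dimension nonnegative. *)
have wX : [set w] \in sd (around c).
  by have := wc; rewrite -[in X in X -> _]vertices_sd_around inE.
apply: (reach_star_decomposable (@sd_complex (around c)) Xpure Xdim _ _ _ yA).
- by have [_ /(_ _ wX)] := Xdim; rewrite /face_dim cards1.
- by rewrite vertices_sd_around.
- rewrite link_sd_around // vertices_sd_around; apply: IH => //.
  by left.
- by rewrite vertices_sd_around.
Qed.

End Gaps.

(** * The whole subdivision as the case of the empty chain *)

Theorem theorem2 (T : finType) (K : {set {set T}}) (d : int)
  (K_complex : simplicial_complex K) (K_pure : pure K) (K_dim : has_dim K d)
  (K_HRC : HRC K) :
  star_decomposable (sd (sd K)) (vertices (sd K)).
Proof.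
have [[s0 s0K ds0] dmax] := K_dim.
have K0 : set0 \in K by apply: K_complex s0K (sub0set _).
(* A face of top dimension is a facet; by purity its cardinality is the common [n]. *)
have s0F : s0 \in facets K.
  rewrite inE; apply/maxsetP; split=> // t tK s0t.
  apply/esym/eqP; rewrite eqEcard s0t.
  by have := dmax t tK; rewrite -ds0 /face_dim; lia.
have KF : {in facets K, forall s : {set T}, #|s| = #|s0|}.
  by move=> s /K_pure/(_ s0F); rewrite /face_dim; lia.
have c0 : set0 \in sd K.
  by rewrite inE sub0set inE /=; apply/forall_inP => s; rewrite inE.
(* Only the empty face is lost from [K], and it occurs in no chain. *)
have sdK : sd (around K set0) = sd K.
  apply/setP=> S; rewrite !inE; apply/and3P/and3P => -[/subsetP SK S0 ch]; split=> //.
    by apply/subsetP => s /SK; rewrite inE => /andP[].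
  apply/subsetP => s sS; rewrite inE SK // inE /=; apply/andP; split.
    by apply: contraNneq S0 => <-.
  by apply/forall_inP => b; rewrite inE.
rewrite -sdK vertices_sd_around.
by apply: (good_star_decomposable K_complex KF) => //; left.
Qed.
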